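(* Let $H$ be a separable Hilbert space, let $[a,b]$ be a finite interval, and let $\{A_n\}_{n\ge 1}$ be a sequence of self-adjoint operators in $H$ with absolutely continuous spectrum on $[a,b]$. Let $\Phi\subset H$ be a dense set such that the strong limit $\lim_{n\to\infty}A_n$ exists on $\Phi$ and the closure of this limit operator is a self-adjoint operator $A$ (so $\lim_{n\to\infty}\|(A_n-A)e\|=0$ for every $e\in\Phi$). Suppose $[a,b]\subseteq\sigma(A)$. Let $E^{(n)}_\lambda$ and $E_\lambda$ be the resolutions of the identity of $A_n$ and $A$, and for $e\in H$ put $\sigma_n(\lambda;e)=(E^{(n)}_\lambda e,e)$ and $\sigma(\lambda;e)=(E_\lambda e,e)$, so that $\sigma_n(\lambda;e)=\sigma_n(a;e)+\int_a^\lambda f_n(t;e)\,dt$ for $\lambda\in[a,b]$ with nonnegative summable $f_n(\cdot;e)$. Suppose that for every vector $e$ from a generating subspace of $A$ the sequence of functions $\{\sigma_n(\lambda;e)\}_n$ is equi-absolutely continuous on $[a,b]$ (equivalently, the sequence $\{f_n(t;e)\}_n$ has equi-absolutely continuous integrals on $[a,b]$). Then the spectrum of $A$ on $[a,b]$ is absolutely continuous. Moreover, under these conditions, for every $e$ in that generating subspace, the sequence $\sigma_n(\lambda;e)$ converges to $\sigma(\lambda;e)$ uniformly on $[a,b]$.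
   Context: Operators may be unbounded; $\Phi$ is contained in the domains of the operators involved, and the closure of the limit operator on $\Phi$ is the operator whose graph is the closure in $H\times H$ of $\{(e,\lim_n A_ne): e\in\Phi\}$. A self-adjoint operator $T$ with resolution of the identity (spectral family) $E^T_\lambda$ has absolutely continuous spectrum on $[a,b]$ if for every $e\in H$ the function $\lambda\mapsto(E^T_\lambda e,e)$ is absolutely continuous on $[a,b]$. A generating subspace of $A$ is a subspace $G\subseteq H$ such that the closed linear span of the vectors $E(\Delta)g$, with $g\in G$ and $\Delta$ ranging over intervals of $\mathbb R$, is all of $H$, where $E(\cdot)$ is the spectral measure of $A$. A sequence of absolutely continuous functions $g_n(x)=g_n(a)+\int_a^x f_n(t)\,dt$ on $[a,b]$ is equi-absolutely continuous on $[a,b]$ if for every $\epsilon>0$ there is $\delta>0$, independent of $n$, such that $\left|\int_S f_n(t)\,dt\right|<\epsilon$ for all $n$ and all measurable $S\subset[a,b]$ with Lebesgue measure $m(S)<\delta$. In this case the sequence of summable functions $f_n$ is said to have equi-absolutely continuous integrals on $[a,b]$.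
   Formalization: The conclusions are proved for a resolution of the identity of A that may differ from the given E_λ in its one-sided normalization at λ=a and λ=b only, since with a fixed normalization eigenvalues of A_n outside [a,b] may converge to an endpoint and the claim fails; also a<b is assumed. *)

(* Defs.v *)
From HB Require Import structures.
From mathcomp Require Import all_boot all_order all_algebra.
From mathcomp Require Import complex.
From mathcomp Require Import all_classical all_reals all_analysis.
Set Implicit Arguments.
Unset Strict Implicit.
Unset Printing Implicit Defensive.
Import Order.TTheory GRing.Theory Num.Theory.
Import numFieldNormedType.Exports.
Local Open Scope classical_set_scope.
Local Open Scope ring_scope.

(* A complex Hilbert space is a [completeNormedModType R[i]] with an inner
   product [dot : {dot H for Num.conj}], linear in its first argument, that
   induces the norm. *)

Definition separable (T : topologicalType) : Prop :=
  exists2 D : set T, countable D & dense D.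

Definition linear_subspace (C : numFieldType) (H : lmodType C) (V : set H) :=
  V 0 /\ forall (c : C) (x y : H), V x -> V y -> V (c *: x + y).

Definition linear_span (C : numFieldType) (H : lmodType C) (S : set H)
    : set H :=
  [set x | exists (n : nat) (c : 'I_n -> C) (v : 'I_n -> H),
     (forall i, S (v i)) /\ x = \sum_(i < n) c i *: v i].

(* A possibly unbounded operator; the values of [op_app] off [op_dom] carry no
   meaning, so operators are compared through their graphs. *)
Record operator (C : numFieldType) (H : lmodType C) := Operator {
  op_dom : set H;
  op_app :> H -> H;
  op_dom_linear : linear_subspace op_dom;
  op_app_linear : forall (c : C) (x y : H), op_dom x -> op_dom y ->
    op_app (c *: x + y) = c *: op_app x + op_app y
}.

Section Operators.
Context {R : realType} {H : completeNormedModType R[i]}.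
Variable dot : {dot H for (@Num.conj R[i])}.

Definition op_graph (A : operator H) : set (H * H) :=
  [set p | op_dom A p.1 /\ p.2 = A p.1].

Definition adjoint_graph (A : operator H) : set (H * H) :=
  [set p | forall x, op_dom A x -> dot (A x) p.1 = dot x p.2].

Definition self_adjoint (A : operator H) : Prop :=
  dense (op_dom A) /\ op_graph A = adjoint_graph A.

Definition strong_limit_graph (A : nat -> operator H) (Phi : set H)
    : set (H * H) :=
  [set p | Phi p.1 /\ (fun n => A n p.1) @ \oo --> p.2].

Definition resolvent_set (A : operator H) : set R[i] :=
  [set z | exists B : H -> H,
    [/\ exists M : R[i], forall x, `|B x| <= M * `|x|,
        forall x, op_dom A (B x) /\ A (B x) - z *: B x = x
      & forall x, op_dom A x -> B (A x - z *: x) = x]].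

Definition spectrum (A : operator H) : set R[i] := ~` resolvent_set A.

Definition orthogonal_projection (Q : H -> H) : Prop :=
  [/\ linear Q, forall x, Q (Q x) = Q x
    & forall x y, dot (Q x) y = dot x (Q y)].

(* Only the values on Borel sets are constrained.  Multiplicativity
   [P (B `&` B') = P B \o P B'] follows from these axioms. *)
Definition projection_valued_measure (P : set R -> H -> H) : Prop :=
  [/\ forall B, measurable B -> orthogonal_projection (P B),
      P setT = id
    & forall F : nat -> set R, (forall i, measurable (F i)) ->
        trivIset setT F -> forall x,
        (fun n => \sum_(i < n) P (F i) x) @ \oo --> P (\bigcup_i F i) x].

(* [A] is the integral of [t] against [P].  The measure [mu] is
   [B |-> (P B x, x)]; it exists for every projection-valued measure and is
   unique on Borel sets.  Since [H] is complex, the quadratic form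
   [x |-> (A x, x)] on the given domain determines [A]. *)
Definition spectral_measure (A : operator H) (P : set R -> H -> H) : Prop :=
  projection_valued_measure P /\
  forall x, exists mu : {measure set (measurableTypeR R) -> \bar R},
    [/\ forall B, measurable B -> (mu B = (complex.Re (dot (P B x) x))%:E)%E,
        op_dom A x <-> (\int[mu]_t (t ^+ 2)%:E < +oo)%E
      & op_dom A x -> dot (A x) x = ((\int[mu]_t t)%:C)%C].

(* The spectral family of the spectral measure [P].  Its value at a jump [l]
   is conventional: left-continuous families have [E l = P `]-oo, l[], and
   right-continuous ones [E l = P `]-oo, l]].  Both normalizations are
   admitted, at each [l] separately: with [E] fixed to be, say,
   right-continuous, eigenvalues of [A n] lying outside [`[a, b]] may converge
   to an eigenvalue of the limit operator at [b], and then [(E l e, e)] jumps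
   at [b] although all [(E_n l e, e)] are equi-absolutely continuous on
   [`[a, b]]; a left-continuous [E] has the same defect at [a]. *)
Definition resolution_of_identity (P : set R -> H -> H) (E : R -> H -> H) :=
  forall l : R, E l = P (`]-oo, l[%classic) \/ E l = P (`]-oo, l]%classic).

Definition spectral_function (E : R -> H -> H) (e : H) (l : R) : R :=
  complex.Re (dot (E l e) e).

Definition generating_subspace (P : set R -> H -> H) (G : set H) : Prop :=
  linear_subspace G /\
  closure (linear_span
    [set x | exists (D : interval R) (g : H), G g /\ x = P [set` D] g])
  = setT.

End Operators.

Definition absolutely_continuous_on {R : realType} (a b : R) (g : R -> R) :=
  forall eps : R, 0 < eps -> exists2 delta : R, 0 < delta &
    forall (n : nat) (x y : 'I_n -> R),
      (forall i, a <= x i /\ x i <= y i /\ y i <= b) ->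
      trivIset setT (fun i => `]x i, y i[%classic) ->
      \sum_(i < n) (y i - x i) < delta ->
      \sum_(i < n) `|g (y i) - g (x i)| < eps.

Definition equi_absolutely_continuous {R : realType} (a b : R)
    (g : nat -> R -> R) : Prop :=
  let m := @lebesgue_measure R in
  exists f : nat -> R -> R,
    [/\ forall n, m.-integrable `[a, b] (EFin \o f n),
        forall n x, x \in `[a, b] ->
          g n x = g n a + \int[m]_(t in `[a, x]) f n t
      & forall eps : R, 0 < eps -> exists2 delta : R, 0 < delta &
          forall (n : nat) (S : set R), measurable S -> S `<=` `[a, b] ->
            (m S < delta%:E)%E -> `|\int[m]_(t in S) f n t| < eps].

Definition ac_spectrum_on {R : realType} {H : completeNormedModType R[i]}
    (dot : {dot H for (@Num.conj R[i])}) (a b : R) (E : R -> H -> H) : Prop :=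
  forall e, absolutely_continuous_on a b (spectral_function dot E e).

(* Main.v *)
Require Import Defs.
From mathcomp Require Import all_boot all_order all_algebra.
From mathcomp Require Import complex ring lra.
From mathcomp Require Import all_classical all_reals all_analysis.
From mathcomp Require Import measurable_realfun.
Set Implicit Arguments.
Unset Strict Implicit.
Unset Printing Implicit Defensive.
Import Order.TTheory GRing.Theory Num.Theory.
Import numFieldNormedType.Exports.
Local Open Scope classical_set_scope.
Local Open Scope ring_scope.

(** Fix a vector [e] and write [mu B = rnorm (P B e) ^+ 2] for its spectral
    measure under [A], and [mu_n] for the one under [An n].

    The heart of the matter is that [mu_n] converges weakly to [mu]. This is
    obtained without resolvents, from a Chebyshev estimate. Suppose [u] lies in
    the spectral subspace of [A] for [`[c - h, c + h]], so that
    [rnorm ((A - c) u) <= h * rnorm u] ([shift_le]). Approximating [u] in the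
    graph norm by a vector of [Phi], where [An n] converges to [A], one sees that
    [(An n - c) u] is essentially as small, and so the part of [u] that [An n]
    places at distance at least [d] from [c] has norm at most about
    [(h / d) * rnorm u] ([shift_ge], [pvm_escape]). A single cell gives only
    this fixed proportion. Cutting a bounded spectral interval into [N] cells of
    length proportional to [1 / N], the orthogonality of the cells makes the sum
    of the norms of the components at most [sqrt N] times the norm of the
    vector, so the total is of order [1 / sqrt N] and hence arbitrarily small.
    Thus [Pn n T (P B e)] tends to [0] as soon as [B] and [T] are at positive
    distance ([pvm_separated]), and [mu_n T] is eventually at most
    [mu (~` B) + eps] ([mass_escape]).

    Applied to rays, this bounds the limits of the distribution functions of
    [mu_n] at a point [l] by those of [mu] at points slightly to the left and
    right of [l]. If the former are equicontinuous on [`[a, b]], the gap can be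
    closed: [mu] has no atom inside the interval
    ([equicontinuous_no_atom]) and the distribution functions converge at every
    point of [`[a, b]] ([spectral_function_cvg]), provided that the limit is
    normalized at [a] and [b] so as to ignore atoms there ([renormalized]).
    Equicontinuity upgrades this to uniform convergence.

    For [e] in the generating subspace, the increments of the limit over
    disjoint intervals of small total length are limits of increments that are
    uniformly small, hence small. Their sum is [rnorm (P S e) ^+ 2] with [S] the
    union of the intervals. The vectors [e] for which [P S e] is small when [S]
    is short form a closed subspace invariant under [P], so they fill [H]
    ([generating_vanishes_on_small]), and the spectrum of [A] on [`[a, b]] is
    absolutely continuous. The commutation of [A] with its spectral projections,
    which the estimates rest on, comes from the additivity of the quadratic form
    ([form_split], [op_pvm_comm]). *)

(** * The underlying real inner product *)

Section RealInnerProduct.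
Context {R : realType} {H : completeNormedModType R[i]}.
Variable dot : {dot H for (@Num.conj R[i])}.

(** The estimates involve real scalars only, so they are phrased with the
    real part of the inner product and a real-valued norm; the hermitian
    symmetry becomes plain symmetry, and inequalities can be decided in [R]. *)
Definition rdot (x y : H) : R := complex.Re (dot x y).
Definition rnorm (x : H) : R := complex.Re `|x|.

Lemma rnormE x : (rnorm x)%:C%C = `|x|.
Proof. by rewrite /rnorm RRe_real // ger0_real. Qed.

Lemma rnorm_ge0 x : 0 <= rnorm x.
Proof. by rewrite -ler0c rnormE. Qed.

Lemma rnorm0 : rnorm 0 = 0.
Proof. by rewrite /rnorm normr0. Qed.

Lemma rnorm0_eq0 x : rnorm x = 0 -> x = 0.
Proof. by move=> x0; apply/eqP; rewrite -normr_eq0 -rnormE x0. Qed.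

Lemma ler_rnormD x y : rnorm (x + y) <= rnorm x + rnorm y.
Proof. by rewrite -lecR rmorphD/= !rnormE ler_normD. Qed.

Lemma rnormN x : rnorm (- x) = rnorm x.
Proof. by rewrite /rnorm normrN. Qed.

Lemma rnormBC x y : rnorm (x - y) = rnorm (y - x).
Proof. by rewrite /rnorm distrC. Qed.

Lemma rnormZ (c : R[i]) x : rnorm (c *: x) = rnorm x * complex.Re `|c|.
Proof.
have cE : (complex.Re `|c|)%:C%C = `|c| by rewrite RRe_real // ger0_real.
have := normrZ c x; rewrite -!rnormE -[X in X * _]cE -rmorphM/= => /complexI ->.
by rewrite mulrC.
Qed.

Lemma rdotC x y : rdot x y = rdot y x.
Proof.
have Re_conj (z : R[i]) : complex.Re (Num.conj z) = complex.Re z by case: z.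
by rewrite /rdot hermC expr0 mul1r Re_conj.
Qed.

Lemma rdotDl x y z : rdot (x + y) z = rdot x z + rdot y z.
Proof. by rewrite /rdot linearDl raddfD. Qed.

Lemma rdotBl x y z : rdot (x - y) z = rdot x z - rdot y z.
Proof. by rewrite /rdot linearBl raddfB. Qed.

Lemma rdotDr x y z : rdot x (y + z) = rdot x y + rdot x z.
Proof. by rewrite rdotC rdotDl !(rdotC x). Qed.

Lemma rdotBr x y z : rdot x (y - z) = rdot x y - rdot x z.
Proof. by rewrite rdotC rdotBl !(rdotC x). Qed.

Lemma rdotZl (r : R) x y : rdot (r%:C%C *: x) y = r * rdot x y.
Proof. by rewrite /rdot linearZl_LR/=; case: (dot x y) => u v /=; ring. Qed.

Lemma rdotZr (r : R) x y : rdot x (r%:C%C *: y) = r * rdot x y.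
Proof. by rewrite rdotC rdotZl rdotC. Qed.

Hypothesis dot_norm : forall x : H, dot x x = `|x| ^+ 2.

Lemma rdotxx x : rdot x x = rnorm x ^+ 2.
Proof. by rewrite /rdot dot_norm -rnormE -rmorphXn. Qed.

Lemma rnormD_sqr x y :
  rnorm (x + y) ^+ 2 = rnorm x ^+ 2 + 2 * rdot x y + rnorm y ^+ 2.
Proof. by rewrite -!rdotxx !rdotDl !rdotDr (rdotC y x); ring. Qed.

Lemma rnormB_sqr x y :
  rnorm (x - y) ^+ 2 = rnorm x ^+ 2 - 2 * rdot x y + rnorm y ^+ 2.
Proof. by rewrite -!rdotxx !rdotBl !rdotBr (rdotC y x); ring. Qed.

(** Read off from the square of the triangle inequality, which the norm of [H]
    satisfies by assumption. *)
Lemma rdot_cauchy x y : `|rdot x y| <= rnorm x * rnorm y.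
Proof.
suff h u v : rdot u v <= rnorm u * rnorm v.
  rewrite ler_norml h andbT lerNl -(rnormN x).
  by have := h (- x) y; rewrite -sub0r rdotBl; have := rdotDl 0 0 y;
    rewrite addr0 => /eqP; rewrite -subr_eq0; lra.
have := ler_rnormD u v; rewrite -(@ler_pXn2r _ 2) ?nnegrE ?addr_ge0 ?rnorm_ge0//.
by rewrite rnormD_sqr sqrrD; lra.
Qed.

Lemma dense_rdot_eq0 (D : set H) z :
  dense D -> (forall y, D y -> rdot z y = 0) -> z = 0.
Proof.
move=> dD zD; apply: rnorm0_eq0; apply/eqP; apply: contrapT => /negP z0.
have z_gt0 : 0 < rnorm z by rewrite lt_def z0 rnorm_ge0.
have [|y [/= By Dy]] := dD (ball z (rnorm z)%:C%C) _ (ball_open _ _).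
  by exists z; apply: ballxx; rewrite ltcR.
move: By; rewrite -ball_normE/= -rnormE ltcR => zy.
have := rdot_cauchy z (z - y); rewrite rdotBr (zD _ Dy) subr0 rdotxx.
rewrite ger0_norm ?sqr_ge0// expr2 ler_pM2l// => /le_lt_trans/(_ zy).
by rewrite ltxx.
Qed.

End RealInnerProduct.

(** * Calculus of projection-valued measures *)

Section SpectralMeasure.
Context {R : realType} {H : completeNormedModType R[i]}.
Variable dot : {dot H for (@Num.conj R[i])}.
Hypothesis dot_norm : forall x : H, dot x x = `|x| ^+ 2.
Variables (A : operator H) (P : set R -> H -> H).
Hypothesis A_P : spectral_measure dot A P.

Local Notation mass B x := (rnorm (P B x) ^+ 2).

Lemma pvmD B x y : measurable B -> P B (x + y) = P B x + P B y.
Proof. by case: A_P => -[PB _ _] _ /PB[/(_ 1 x y)]; rewrite !scale1r. Qed.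

Lemma pvm0 B : measurable B -> P B 0 = 0.
Proof.
by move=> mB; have /eqP := pvmD 0 0 mB; rewrite addr0 -subr_eq0 opprD addNKr
  oppr_eq0 => /eqP.
Qed.

Lemma pvmZ B c x : measurable B -> P B (c *: x) = c *: P B x.
Proof.
move=> mB; case: A_P => -[PB _ _] _; have [/(_ c x 0)] := PB _ mB.
by rewrite pvm0// !addr0.
Qed.

Lemma pvmB B x y : measurable B -> P B (x - y) = P B x - P B y.
Proof. by move=> mB; rewrite pvmD// -scaleN1r pvmZ// scaleN1r. Qed.

Lemma pvm_idem B x : measurable B -> P B (P B x) = P B x.
Proof. by case: A_P => -[PB _ _] _ /PB[_ ->]. Qed.

Lemma pvm_adj B x y : measurable B -> rdot dot (P B x) y = rdot dot x (P B y).
Proof. by case: A_P => -[PB _ _] _ /PB[_ _]; rewrite /rdot => ->. Qed.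

Lemma pvmT x : P setT x = x.
Proof. by case: A_P => -[_ -> _] _. Qed.

Lemma spectral_massE x B : measurable B ->
  complex.Re (dot (P B x) x) = mass B x.
Proof.
by move=> mB; rewrite -(rdotxx dot_norm) pvm_adj// pvm_idem// rdotC.
Qed.

Lemma spectral_measureP x :
  exists mu : {measure set (measurableTypeR R) -> \bar R},
    [/\ forall B : set R, measurable B -> mu B = (mass B x)%:E,
        op_dom A x <-> (\int[mu]_t (t ^+ 2)%:E < +oo)%E
      & op_dom A x -> rdot dot (A x) x = \int[mu]_t t].
Proof.
have [mu [muE mu_dom mu_form]] := A_P.2 x; exists mu; split => //.
  by move=> B mB; rewrite muE// spectral_massE.
by move=> /mu_form; rewrite /rdot => ->.
Qed.

Lemma mass_setT x : mass setT x = rnorm x ^+ 2.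
Proof. by rewrite pvmT. Qed.

Lemma massU B C x : measurable B -> measurable C -> B `&` C = set0 ->
  mass (B `|` C) x = mass B x + mass C x.
Proof.
move=> mB mC BC; have [mu [muE _ _]] := spectral_measureP x.
apply: EFin_inj; rewrite EFinD -(muE B)// -(muE C)// -muE ?measureU//.
exact: measurableU.
Qed.

Lemma mass_bigsetU n (D : 'I_n -> set R) x : (forall i, measurable (D i)) ->
  trivIset setT D -> mass (\big[setU/set0]_(i < n) D i) x = \sum_(i < n) mass (D i) x.
Proof.
move=> mD tD; have [mu [muE _ _]] := spectral_measureP x.
apply: EFin_inj; rewrite -[LHS]muE; last exact: bigsetU_measurable.
by rewrite measure_bigsetU_ord// -sumEFin; apply: eq_bigr => i _; exact: muE.
Qed.

Lemma massC B x : measurable B -> mass (~` B) x = rnorm x ^+ 2 - mass B x.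
Proof.
move=> mB; rewrite -(mass_setT x) -(setUv B) massU ?setICr//; first by ring.
exact: measurableC.
Qed.

Lemma mass_le B C x : measurable B -> measurable C -> B `<=` C ->
  mass B x <= mass C x.
Proof.
move=> mB mC BC; have [mu [muE _ _]] := spectral_measureP x.
by rewrite -lee_fin -!muE// le_measure// inE.
Qed.

Lemma rnorm_pvm_le B x : measurable B -> rnorm (P B x) <= rnorm x.
Proof.
move=> mB; rewrite -(@ler_pXn2r _ 2) ?nnegrE ?rnorm_ge0//.
by rewrite -(mass_setT x) mass_le.
Qed.

Lemma mass_orth B x : measurable B ->
  rnorm (x - P B x) ^+ 2 = rnorm x ^+ 2 - mass B x.
Proof.
move=> mB; have xPx : rdot dot x (P B x) = mass B x.
  by rewrite -[in LHS](pvm_idem x mB) -pvm_adj// rdotxx.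
by rewrite (rnormB_sqr dot_norm) xPx; ring.
Qed.

(** Turns information on masses, which add up like a measure, into identities
    between vectors; multiplicativity of [P] is derived in this way. *)
Lemma pvm_fix B x : measurable B -> rnorm x ^+ 2 <= mass B x -> P B x = x.
Proof.
move=> mB xB; apply/esym/eqP; rewrite -subr_eq0; apply/eqP/rnorm0_eq0/eqP.
by rewrite -sqrf_eq0 eq_le sqr_ge0 mass_orth// subr_le0 xB.
Qed.

Lemma pvm_subr B C x : measurable B -> measurable C -> B `<=` C ->
  P C (P B x) = P B x.
Proof.
move=> mB mC BC; apply: pvm_fix => //.
by rewrite -{1}(pvm_idem x mB) mass_le.
Qed.

Lemma pvm_subl B C x : measurable B -> measurable C -> B `<=` C ->
  P B (P C x) = P B x.
Proof.
move=> mB mC BC; apply/eqP; rewrite -subr_eq0; apply/eqP.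
apply: (dense_rdot_eq0 dot_norm (D := setT)).
  by move=> U [y Uy] _; exists y.
by move=> y _; rewrite rdotBl !pvm_adj// pvm_subr// subrr.
Qed.

Lemma pvmC B x : measurable B -> P (~` B) x = x - P B x.
Proof.
move=> mB; have mC := measurableC mB.
have B0 : P (~` B) (P B x) = 0.
  apply: rnorm0_eq0; apply/eqP; rewrite -sqrf_eq0 massC// pvm_idem//.
  by rewrite subrr.
rewrite -{1}(subrK (P B x) x) pvmD// B0 addr0.
apply: pvm_fix => //; rewrite massC//.
by rewrite [P B (_ - _)]pvmB// pvm_idem// subrr rnorm0 expr0n subr0.
Qed.

Lemma pvm_set0 x : P set0 x = 0.
Proof. by rewrite -setCT pvmC// pvmT subrr. Qed.

(** On [v := P C x] all mass sits in [C], so [P B v] and [P (B `&` C) v] have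
    the same norm, while the second is the projection of the first. *)
Lemma pvmI B C x : measurable B -> measurable C -> P B (P C x) = P (B `&` C) x.
Proof.
move=> mB mC; have mI := measurableI _ _ mB mC.
have mD : measurable (B `\` C) by exact: measurableD.
rewrite -[RHS](pvm_subl x mI mC); last exact: subIsetr.
set v := P C x; have vB : mass B v = mass (B `&` C) v.
  rewrite -{1}(setUIDK B C) massU//; last by rewrite setDE setIACA setICr setI0.
  suff -> : mass (B `\` C) v = 0 by rewrite addr0.
  apply/eqP; rewrite eq_le sqr_ge0 andbT.
  have -> : 0 = mass (~` C) v.
    by rewrite pvmC// [P C v]pvm_idem// subrr rnorm0 expr0n.
  by apply: mass_le => [||t []] //; exact: measurableC.
have <- : P (B `&` C) (P B v) = P (B `&` C) v.
  by apply: pvm_subl => //; exact: subIsetl.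
by apply/esym/pvm_fix => //; rewrite pvm_subl ?vB//; exact: subIsetl.
Qed.

Lemma pvm_comm B C x : measurable B -> measurable C ->
  P B (P C x) = P C (P B x).
Proof. by move=> mB mC; rewrite !pvmI// setIC. Qed.

Lemma pvmU B C x : measurable B -> measurable C -> B `&` C = set0 ->
  P (B `|` C) x = P B x + P C x.
Proof.
move=> mB mC BC; have mU := measurableU _ _ mB mC; have mBc := measurableC mB.
have -> : P (B `|` C) x = P B (P (B `|` C) x) + P (~` B) (P (B `|` C) x).
  by rewrite pvmC// addrC subrK.
rewrite !pvmI//; congr (P _ x + P _ x); first by rewrite [B `|` C]setUC setKU.
rewrite setIUr setICl set0U; apply/seteqP; split => [t []//|t Ct]; split => //.
by move=> Bt; have : (B `&` C) t by []; rewrite BC.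
Qed.

(** Countable additivity is inherited from the scalar measure of
    [spectral_measureP]. *)
Lemma mass_cvg_bigcup (F : nat -> set R) x : (forall i, measurable (F i)) ->
  {homo F : n m / (n <= m)%N >-> (n <= m)%O} ->
  (fun n => mass (F n) x) @ \oo --> mass (\bigcup_n F n) x.
Proof.
move=> mF hF; have [mu [muE _ _]] := spectral_measureP x.
have mU : measurable (\bigcup_n F n) by exact: bigcup_measurable.
have -> : (fun n => mass (F n) x) = fine \o (mu \o F).
  by apply/funext => n /=; rewrite muE.
by apply: fine_cvg; rewrite -(muE _ mU); exact: nondecreasing_cvg_mu.
Qed.

Lemma mass_cvg_bigcap (F : nat -> set R) x : (forall i, measurable (F i)) ->
  {homo F : n m / (n <= m)%N >-> (m <= n)%O} ->
  (fun n => mass (F n) x) @ \oo --> mass (\bigcap_n F n) x.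
Proof.
move=> mF hF; have mFC i : measurable (~` F i) by exact: measurableC.
have -> : (fun n => mass (F n) x) =
    (fun n => rnorm x ^+ 2 - mass (~` F n) x).
  by apply/funext => n; rewrite massC//; ring.
have -> : mass (\bigcap_n F n) x =
    rnorm x ^+ 2 - mass (\bigcup_n ~` F n) x.
  by rewrite -setC_bigcap massC//; [ring|exact: bigcap_measurable].
apply: cvgB; first exact: cvg_cst.
by apply: mass_cvg_bigcup => // n m nm; apply/subsetPset/subsetC/subsetPset/hF.
Qed.

(** Reduces statements about arbitrary vectors to vectors of bounded spectral
    support, which lie in the domain and on which the operator is bounded. *)
Lemma pvm_truncate x eps : 0 < eps ->
  exists2 L : R, 0 < L & rnorm (x - P `](- L), L]%classic x) < eps.
Proof.
move=> e0; pose F n : set R := `](- n.+1%:R), n.+1%:R]%classic.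
have hF : {homo F : n m / (n <= m)%N >-> (n <= m)%O}.
  move=> n m nm; apply/subsetPset; apply: subset_itv; rewrite bnd_simp.
    by rewrite lerN2 ler_nat ltnS.
  by rewrite ler_nat ltnS.
have FT : \bigcup_n F n = setT.
  apply/seteqP; split => // t _; exists (Num.truncn `|t|) => //=.
  have : `|t| < (Num.truncn `|t|).+1%:R by exact: truncnS_gt.
  by rewrite /F /= in_itv/= ltr_norml => /andP[-> /ltW].
have := @mass_cvg_bigcup F x (fun n => measurable_itv _) hF.
rewrite FT mass_setT => /cvgrPdist_lt/(_ (eps ^+ 2)).
move=> /(_ (exprn_gt0 _ e0))[n _ /(_ n (leqnn n)) /=] xn.
exists n.+1%:R => //; rewrite -(@ltr_pXn2r _ 2) ?nnegrE ?rnorm_ge0 ?ltW//.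
by rewrite mass_orth//; exact: le_lt_trans (ler_norm _) xn.
Qed.

End SpectralMeasure.

(** * First and second moments of a finite measure *)

Section Moments.
Context {R : realType} (mu : {measure set (measurableTypeR R) -> \bar R}).
Hypothesis mu_fin : (mu setT < +oo)%E.

Lemma integrable_cst_finite (k : R) :
  mu.-integrable setT (cst k%:E).
Proof.
apply/integrableP; split; first exact: measurable_cst.
by rewrite integral_cst// lte_mul_pinfty// abse_ge0.
Qed.

(** Comparison with [1 + t ^+ 2]. *)
Lemma integrable_of_moment2 : (\int[mu]_t (t ^+ 2)%:E < +oo)%E ->
  mu.-integrable setT (fun t => t%:E).
Proof.
move=> m2; apply: (@le_integrable _ _ _ _ _ _ _
  (fun t : measurableTypeR R => 1%:E + (t ^+ 2)%:E)%E).
- exact: measurableT.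
- by apply/measurable_EFinP; exact: measurable_id.
- move=> t _; rewrite -EFinD !abse_EFin lee_fin.
  by rewrite [leRHS]ger0_norm ?addr_ge0 ?sqr_ge0// ler_norml; apply/andP; split;
    nra.
- apply: integrableD => //; first exact: integrable_cst_finite.
  apply/integrableP; split.
    by apply/measurable_EFinP; exact: measurable_funX.
  by under eq_integral do rewrite abse_EFin ger0_norm ?sqr_ge0//.
Qed.

Lemma moment2_bounded_support (B : set (measurableTypeR R)) (M : R) : measurable B ->
  mu (~` B) = 0%E -> (forall t, B t -> `|t| <= M) ->
  (\int[mu]_t (t ^+ 2)%:E < +oo)%E.
Proof.
move=> mB B0 BM; apply: (@le_lt_trans _ _ (\int[mu]_t (M ^+ 2)%:E)%E).
  apply: ae_ge0_le_integral => //.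
  - by move=> t _; rewrite lee_fin sqr_ge0.
  - by apply/measurable_EFinP; exact: measurable_funX.
  - by move=> t _; rewrite lee_fin sqr_ge0.
  - exists (~` B); split => //; first exact: measurableC.
    move=> t /= /not_implyP[_ tM] Bt; apply: tM.
    rewrite lee_fin -real_normK ?num_real// -[M ^+ 2]real_normK ?num_real//.
    by rewrite ler_pXn2r ?nnegrE// (le_trans (BM _ Bt)) ?ler_norm.
by rewrite integral_cst// lte_mul_pinfty// lee_fin sqr_ge0.
Qed.

Lemma Rintegral_on_support (B : set (measurableTypeR R)) (f : R -> R) :
  measurable B -> mu (~` B) = 0%E -> mu.-integrable setT (fun t => (f t)%:E) ->
  mu.-integrable B (fun t => (f t)%:E) /\
  \int[mu]_t f t = \int[mu]_(t in B) f t.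
Proof.
move=> mB B0 itf; split; first exact: integrableS itf.
rewrite /Rintegral (negligible_integral (measurableC mB) _ itf)//.
by rewrite setTD setCK.
Qed.

Lemma Rintegral_ge_support (B : set (measurableTypeR R)) (k : R) :
  measurable B -> mu (~` B) = 0%E -> (forall t, B t -> k <= t) ->
  mu.-integrable setT (fun t => t%:E) ->
  k * fine (mu setT) <= \int[mu]_t t.
Proof.
move=> mB B0 Bk it; have ic := integrable_cst_finite k.
have [icB cE] := Rintegral_on_support mB B0 ic.
have [itB tE] := Rintegral_on_support mB B0 it.
by rewrite -Rintegral_cst// cE tE; exact: le_Rintegral.
Qed.

Lemma Rintegral_le_support (B : set (measurableTypeR R)) (k : R) :
  measurable B -> mu (~` B) = 0%E -> (forall t, B t -> t <= k) ->
  mu.-integrable setT (fun t => t%:E) ->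
  \int[mu]_t t <= k * fine (mu setT).
Proof.
move=> mB B0 Bk it; have ic := integrable_cst_finite k.
have [icB cE] := Rintegral_on_support mB B0 ic.
have [itB tE] := Rintegral_on_support mB B0 it.
by rewrite -Rintegral_cst// cE tE; exact: le_Rintegral.
Qed.

End Moments.

(** * Self-adjoint operators and their spectral projections *)

Section SelfAdjoint.
Context {R : realType} {H : completeNormedModType R[i]}.
Variable dot : {dot H for (@Num.conj R[i])}.
Hypothesis dot_norm : forall x : H, dot x x = `|x| ^+ 2.
Variables (A : operator H) (P : set R -> H -> H).
Hypothesis A_sa : self_adjoint dot A.
Hypothesis A_P : spectral_measure dot A P.

Local Notation mass B x := (rnorm (P B x) ^+ 2).
Local Notation dom := (op_dom A).

Lemma op_domD x y : dom x -> dom y -> dom (x + y).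
Proof. by move=> dx dy; have := (op_dom_linear A).2 1 x y dx dy; rewrite scale1r. Qed.

Lemma op_domZ c x : dom x -> dom (c *: x).
Proof.
by move=> dx; have := (op_dom_linear A).2 c x 0 dx (op_dom_linear A).1; rewrite addr0.
Qed.

Lemma opD x y : dom x -> dom y -> A (x + y) = A x + A y.
Proof. by move=> dx dy; have := op_app_linear 1 dx dy; rewrite !scale1r. Qed.

Lemma op0 : A 0 = 0.
Proof.
have d0 := (op_dom_linear A).1.
by have /eqP := opD d0 d0; rewrite addr0 -subr_eq0 opprD addNKr oppr_eq0 => /eqP.
Qed.

Lemma opZ c x : dom x -> A (c *: x) = c *: A x.
Proof.
move=> dx; have := op_app_linear c dx (op_dom_linear A).1.
by rewrite op0 !addr0.
Qed.

Lemma opB x y : dom x -> dom y -> A (x - y) = A x - A y.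
Proof.
move=> dx dy; rewrite -scaleN1r opD//; last exact: op_domZ.
by rewrite opZ// scaleN1r.
Qed.

Lemma op_sym x y : dom x -> dom y -> rdot dot (A x) y = rdot dot x (A y).
Proof.
move=> dx dy; have : adjoint_graph dot A (y, A y) by rewrite -A_sa.2.
by rewrite /rdot => -> .
Qed.

Lemma mass_split B C x : measurable B -> measurable C ->
  mass C x = mass C (P B x) + mass C (P (~` B) x).
Proof.
move=> mB mC; have mBC := measurableC mB.
rewrite !(pvmI dot_norm A_P)//.
rewrite -(massU dot_norm A_P); [|exact: measurableI..|].
  by rewrite -setIUr setUv setIT.
by rewrite setIACA setICr setI0.
Qed.

(** The measures of [P B x] and of [P (~` B) x] add up to that of [x], so both
    the domain and the quadratic form split along a spectral projection. *)
Lemma form_split B x : measurable B -> dom x ->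
  dom (P B x) /\
  rdot dot (A x) x = rdot dot (A (P B x)) (P B x)
                     + rdot dot (A (P (~` B) x)) (P (~` B) x).
Proof.
move=> mB dx; have mBC := measurableC mB.
have [mu [muE mu_dom mu_form]] := spectral_measureP dot_norm A_P x.
have [m1 [m1E m1_dom m1_form]] := spectral_measureP dot_norm A_P (P B x).
have [m2 [m2E m2_dom m2_form]] := spectral_measureP dot_norm A_P (P (~` B) x).
have mu_add (C : set (measurableTypeR R)) : measurable C -> C `<=` setT ->
    mu C = measure_add m1 m2 C.
  move=> mC _; rewrite measure_addE muE// m1E// m2E// -EFinD.
  by rewrite (@mass_split B).
have m1_fin : (m1 setT < +oo)%E by rewrite m1E// ltry.
have m2_fin : (m2 setT < +oo)%E by rewrite m2E// ltry.
have /mu_dom := dx.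
rewrite (eq_measure_integral _ mu_add) ge0_integral_measure_add//; first last.
- by apply/measurable_EFinP; exact: measurable_funX.
- by move=> t _; rewrite lee_fin sqr_ge0.
move=> sum_fin.
have ge0 (m : {measure set (measurableTypeR R) -> \bar R}) :
    (0 <= \int[m]_t (t ^+ 2)%:E)%E.
  by apply: integral_ge0 => t _; rewrite lee_fin sqr_ge0.
have f1 : (\int[m1]_t (t ^+ 2)%:E < +oo)%E.
  by apply: le_lt_trans sum_fin; rewrite leeDl.
have f2 : (\int[m2]_t (t ^+ 2)%:E < +oo)%E.
  by apply: le_lt_trans sum_fin; rewrite leeDr.
have d1 : dom (P B x) by apply/m1_dom.
have d2 : dom (P (~` B) x) by apply/m2_dom.
split => //; rewrite mu_form// m1_form// m2_form// /Rintegral.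
have i1 := integrable_of_moment2 m1_fin f1.
have i2 := integrable_of_moment2 m2_fin f2.
rewrite (eq_measure_integral _ mu_add) integral_measure_add// fineD//.
- exact: integrable_fin_num i1.
- exact: integrable_fin_num i2.
Qed.

Lemma dom_pvm B x : measurable B -> dom x -> dom (P B x).
Proof. by move=> mB dx; case: (form_split mB dx). Qed.

(** By [form_split], the form has no cross terms between the ranges of [P B]
    and of [P (~` B)]; as the domain is dense, [A] maps each of them to
    itself. *)
Lemma op_pvm_comm B x : measurable B -> dom x -> P B (A x) = A (P B x).
Proof.
move=> mB dx; have mC := measurableC mB.
have cross C z : measurable C -> dom z -> P (~` C) (A (P C z)) = 0.
  move=> {}mC dz; have mCC := measurableC mC.
  apply: (dense_rdot_eq0 dot_norm A_sa.1) => y dy.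
  rewrite (pvm_adj A_P)//.
  have du := dom_pvm mC dz; have dv := dom_pvm mCC dy.
  have [_] := form_split mC (op_domD du dv).
  rewrite !(pvmD A_P)// !(pvm_idem A_P)//.
  rewrite ![P C (P (~` C) y)](pvmI dot_norm A_P)// setICr.
  rewrite ![P (~` C) (P C z)](pvmI dot_norm A_P)// setICl.
  rewrite !(pvm_set0 dot_norm A_P) addr0 add0r opD// !rdotDl !rdotDr.
  rewrite (op_sym dv du) (rdotC dot (P (~` C) y)).
  lra.
have xE : x = P B x + P (~` B) x by rewrite (pvmC dot_norm A_P)// addrC subrK.
have dB := dom_pvm mB dx; have dC := dom_pvm mC dx.
rewrite {1}xE opD// (pvmD A_P)//.
have := cross _ _ mC dx; rewrite setCK => ->; rewrite addr0.
have := cross _ _ mB dx; rewrite (pvmC dot_norm A_P)// => /eqP.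
by rewrite subr_eq0 => /eqP <-.
Qed.

Section Shift.
Variable c : R.
Local Notation shift x := (A x - c%:C%C *: x).

(** The spectral support of [x] confines the Rayleigh quotient
    [rdot (A x) x / rnorm x ^+ 2]. *)
Lemma form_bounds B x : measurable B -> dom x -> P B x = x ->
  (forall k, (forall t, B t -> k <= t) ->
     k * rnorm x ^+ 2 <= rdot dot (A x) x) /\
  (forall k, (forall t, B t -> t <= k) ->
     rdot dot (A x) x <= k * rnorm x ^+ 2).
Proof.
move=> mB dx Bx.
have [mu [muE mu_dom mu_form]] := spectral_measureP dot_norm A_P x.
have mu_fin : (mu setT < +oo)%E by rewrite muE// ltry.
have B0 : mu (~` B) = 0%E.
  rewrite muE; last exact: measurableC.
  by rewrite (pvmC dot_norm A_P)// Bx subrr rnorm0 expr0n.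
have it := integrable_of_moment2 mu_fin (mu_dom.1 dx).
have <- : fine (mu setT) = rnorm x ^+ 2 by rewrite muE//= (pvmT A_P).
rewrite (mu_form dx); split => k Bk.
  exact: (Rintegral_ge_support mu_fin mB B0 Bk it).
exact: (Rintegral_le_support mu_fin mB B0 Bk it).
Qed.

Lemma dom_bounded_support B x M : measurable B -> P B x = x ->
  (forall t, B t -> `|t| <= M) -> dom x.
Proof.
move=> mB Bx BM.
have [mu [muE mu_dom _]] := spectral_measureP dot_norm A_P x.
apply/mu_dom; apply: moment2_bounded_support BM => //.
- by rewrite muE// ltry.
- rewrite muE; last exact: measurableC.
  by rewrite (pvmC dot_norm A_P)// Bx subrr rnorm0 expr0n.
Qed.

Lemma rdot_shift x y :
  rdot dot (shift x) y = rdot dot (A x) y - c * rdot dot x y.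
Proof. by rewrite rdotBl rdotZl. Qed.

Lemma pvm_shift B x : measurable B -> dom x -> P B (shift x) = shift (P B x).
Proof. by move=> mB dx; rewrite (pvmB A_P)// op_pvm_comm// (pvmZ A_P). Qed.

(** [A - c] is symmetric on the range of [P B] and its form there is bounded
    by [h], hence so is its norm: polarize at [x] and [(A - c) x / h]. *)
Lemma shift_le B x h : measurable B -> P B x = x -> 0 < h ->
  (forall t, B t -> `|t - c| <= h) ->
  dom x /\ rnorm (shift x) <= h * rnorm x.
Proof.
move=> mB Bx h0 Bh.
have dB z : P B z = z -> dom z.
  move=> Bz; apply: (dom_bounded_support (M := h + `|c|) mB Bz) => t Bt.
  by rewrite -[t](subrK c) (le_trans (ler_normD _ _))// lerD2r Bh.
have dx := dB _ Bx; split => //.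
(* the choice that makes the polarized inequality sharp *)
pose y := h^-1%:C%C *: shift x.
have By : P B y = y by rewrite (pvmZ A_P)// pvm_shift// Bx.
have dy := dB _ By.
have form_le z : P B z = z -> `|rdot dot (shift z) z| <= h * rnorm z ^+ 2.
  move=> Bz; have [lo up] := form_bounds mB (dB _ Bz) Bz.
  have := lo (c - h); have := up (c + h).
  rewrite rdot_shift rdotxx// ler_norml => {}up {}lo.
  have /up : forall t, B t -> t <= c + h.
    by move=> t /Bh; rewrite ler_norml => /andP[_]; lra.
  have /lo : forall t, B t -> c - h <= t.
    by move=> t /Bh; rewrite ler_norml => /andP[]; lra.
  by move=> ? ?; apply/andP; split; lra.
have : P B (x + y) = x + y by rewrite (pvmD A_P)// Bx By.
have : P B (x - y) = x - y by rewrite (pvmB A_P)// Bx By.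
move=> /form_le + /form_le; rewrite !ler_norml => /andP[f1 _] /andP[_ f2].
have {}f : 4 * rdot dot (shift x) y <= 2 * h * (rnorm x ^+ 2 + rnorm y ^+ 2).
  move: f1 f2; rewrite (rnormB_sqr dot_norm) (rnormD_sqr dot_norm).
  rewrite !rdot_shift opB// opD// !rdotBl !rdotDl !rdotBr !rdotDr.
  rewrite (op_sym dy dx) (rdotC dot y (A x)) (rdotC dot y x).
  by nra.
have y2 : h * rdot dot (shift x) y = rnorm (shift x) ^+ 2.
  by rewrite /y rdotZr rdotxx// mulrA mulfV ?gt_eqF// mul1r.
have yy : h ^+ 2 * rnorm y ^+ 2 = rnorm (shift x) ^+ 2.
  by rewrite -(rdotxx dot_norm) {1}/y rdotZl mulrA expr2 mulfK ?gt_eqF// y2.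
rewrite -(@ler_pXn2r _ 2) ?nnegrE ?rnorm_ge0 ?mulr_ge0 ?rnorm_ge0 ?(ltW h0)//.
rewrite exprMn.
have : h * (4 * rdot dot (shift x) y)
    <= h * (2 * h * (rnorm x ^+ 2 + rnorm y ^+ 2)) by rewrite ler_pM2l.
by nra.
Qed.

(** Quantitative form of the fact that a spectral subspace away from [c] is
    one where [A - c] is bounded below. *)
Lemma shift_ge (T : set R) x (d : R) : measurable T -> dom x -> 0 < d ->
  (forall t, T t -> d <= `|t - c|) -> d * rnorm (P T x) <= rnorm (shift x).
Proof.
move=> mT dx d0 Td.
(* on either side of [c] the form of [A - c] has a constant sign, so it is
   bounded below by [d] in absolute value *)
have one_sided (S : set R) (z := P S x) : measurable S ->
    (forall t, S t -> c + d <= t) \/ (forall t, S t -> t <= c - d) ->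
    d ^+ 2 * mass S x <= mass S (shift x).
  move=> mS Sd; have dz : dom z := dom_pvm mS dx.
  have Sz : P S z = z by rewrite /z (pvm_idem A_P).
  rewrite pvm_shift// -/z -exprMn.
  rewrite ler_pXn2r ?nnegrE ?mulr_ge0 ?rnorm_ge0 ?(ltW d0)//.
  have [->|z0] := eqVneq (rnorm z) 0; first by rewrite mulr0 rnorm_ge0.
  have {z0} z0 : 0 < rnorm z by rewrite lt_def z0 rnorm_ge0.
  rewrite -(ler_pM2r z0); apply: le_trans (rdot_cauchy dot_norm _ _).
  rewrite rdot_shift rdotxx//.
  have [lo up] := form_bounds mS dz Sz.
  case: Sd => [/lo|/up] {lo up} h.
    by apply: le_trans (ler_norm _); nra.
  by rewrite -normrN; apply: le_trans (ler_norm _); nra.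
pose Tp := T `&` `[c, +oo[%classic; pose Tn := T `&` `]-oo, c[%classic.
have mTp : measurable Tp by exact: measurableI.
have mTn : measurable Tn by exact: measurableI.
have TE : T = Tp `|` Tn.
  apply/seteqP; split => [t Tt|t [[]|[]]//].
  by have [ct|ct] := leP c t; [left|right]; split => //=; rewrite in_itv/= ?ct.
have T0 : Tp `&` Tn = set0.
  by apply/seteqP; split => // t [[_ +] [_ +]]; rewrite /= !in_itv/=; lra.
have hp : d ^+ 2 * mass Tp x <= mass Tp (shift x).
  apply: one_sided => //; left => t [/Td + +].
  by rewrite /= in_itv/= andbT => + ct; rewrite ger0_norm; lra.
have hn : d ^+ 2 * mass Tn x <= mass Tn (shift x).
  apply: one_sided => //; right => t [/Td + +].
  by rewrite /= in_itv/= => + ct; rewrite ltr0_norm; lra.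
have := rnorm_pvm_le dot_norm A_P (shift x) mT.
apply: le_trans; rewrite -(@ler_pXn2r _ 2) ?nnegrE ?mulr_ge0 ?rnorm_ge0 ?(ltW d0)//.
by rewrite exprMn TE !(massU dot_norm A_P)// mulrDr lerD.
Qed.

End Shift.
End SelfAdjoint.

(** * Spectral mass under strong convergence on a core *)

Section Convergence.
Context {R : realType} {H : completeNormedModType R[i]}.
Variable dot : {dot H for (@Num.conj R[i])}.
Hypothesis dot_norm : forall x : H, dot x x = `|x| ^+ 2.
Variables (An : nat -> operator H) (Pn : nat -> set R -> H -> H).
Hypothesis An_sa : forall n, self_adjoint dot (An n).
Hypothesis An_Pn : forall n, spectral_measure dot (An n) (Pn n).
Variables (A : operator H) (P : set R -> H -> H).
Hypothesis A_sa : self_adjoint dot A.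
Hypothesis A_P : spectral_measure dot A P.
Variable Phi : set H.
Hypothesis Phi_dom : forall n, Phi `<=` op_dom (An n).
Hypothesis An_A : closure (strong_limit_graph An Phi) = op_graph A.

Lemma cvg_rnorm (f : nat -> H) (l : H) : f @ \oo --> l ->
  forall eps : R, 0 < eps -> \forall n \near \oo, rnorm (f n - l) < eps.
Proof.
move=> /cvgrPdist_lt fl eps e0.
have := fl eps%:C%C; rewrite ltcR => /(_ e0); apply: filterS => n.
by rewrite -rnormE ltcR rnormBC.
Qed.

(** Strong convergence is available on [Phi] only; as [A] is the closure of the
    limit operator, the error made in passing from the domain of [A] to [Phi]
    is small in the graph norm. *)
Lemma core_approx u (eta : R) : op_dom A u -> 0 < eta ->
  exists2 v, Phi v & rnorm (u - v) < eta /\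
    \forall n \near \oo, rnorm (An n v - A u) < eta.
Proof.
move=> du e0; have e2 : 0 < eta / 2 by lra.
have : closure (strong_limit_graph An Phi) (u, A u) by rewrite An_A.
have e2C : (0 : R[i]) < (eta / 2)%:C%C by rewrite ltcR.
move=> /(_ _ (nbhsx_ballx (u, A u) _ e2C))[[v l] [[/= Pv vl] [/= uv Aul]]].
move: uv Aul; rewrite -!ball_normE/= -!rnormE !ltcR => uv Aul.
exists v => //; split; first by lra.
have := cvg_rnorm vl e2; apply: filterS => n vn.
rewrite -(subrK l (An n v)) -addrA.
have := ler_rnormD (An n v - l) (l - A u).
by rewrite (rnormBC l); lra.
Qed.

(** A vector spectrally localized within [h] of [c] for [A] is almost
    annihilated by [A - c], hence, along [Phi], by [An n - c]; a Chebyshev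
    estimate bounds its part at distance at least [d] from [c]. *)
Lemma pvm_escape (B T : set R) u (c h d eps : R) :
  measurable B -> measurable T -> P B u = u -> 0 < h -> 0 < d -> 0 < eps ->
  (forall t, B t -> `|t - c| <= h) -> (forall t, T t -> d <= `|t - c|) ->
  \forall n \near \oo, rnorm (Pn n T u) <= h / d * rnorm u + eps.
Proof.
move=> mB mT Bu h0 d0 e0 Bh Td.
have [du uh] := shift_le dot_norm A_sa A_P mB Bu h0 Bh.
(* the errors [eta] in [tri1] and [tri2] add up to at most [eta * K / d] *)
pose K := 2 + `|c| + d; have K0 : 0 < K by have := normr_ge0 c; rewrite /K; lra.
pose eta := eps * d / K; have eta0 : 0 < eta by rewrite divr_gt0// mulr_gt0.
have [v Pv [uv Anv]] := core_approx du eta0.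
move: Anv; apply: filterS => n Anv.
have vd := shift_ge dot_norm (An_sa n) (An_Pn n) mT (Phi_dom n Pv) d0 Td.
have tri1 : rnorm (Pn n T u) <= rnorm (u - v) + rnorm (Pn n T v).
  rewrite -{1}(subrK v u) (pvmD (An_Pn n))//.
  apply: le_trans (ler_rnormD _ _) _; rewrite lerD2r.
  exact: (rnorm_pvm_le dot_norm (An_Pn n)).
have tri2 : rnorm (An n v - c%:C%C *: v) <=
    rnorm (An n v - A u) + rnorm (A u - c%:C%C *: u) + rnorm (u - v) * `|c|.
  have -> : An n v - c%:C%C *: v =
      (An n v - A u) + (A u - c%:C%C *: u) + c%:C%C *: (u - v).
    by rewrite scalerBr -!addrA !addKr.
  apply: le_trans (ler_rnormD _ _) _; rewrite rnormZ.
  apply: lerD; first exact: ler_rnormD.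
  by rewrite normc_def/= expr0n/= addr0 sqrtr_sqr.
have cuv : rnorm (u - v) * `|c| <= eta * `|c|.
  by apply: ler_wpM2r => //; exact: ltW.
have hd : d * (h / d * rnorm u) = h * rnorm u by field; exact: lt0r_neq0.
rewrite -(ler_pM2l d0) mulrDr hd.
have etaE : eta * K = eps * d by rewrite /eta divfK ?gt_eqF.
move: etaE; rewrite /K; nra.
Qed.

(** Cutting the spectrum into [N] cells of length [h], each cell contributes at
    most [(h / d) * rnorm u_i] by [pvm_escape]. The cells are mutually
    orthogonal, so by [2 * rnorm u_i <= s + rnorm u_i ^+ 2 / s] the total is
    controlled by [N * h * s] and [h / s]; the first is small for [s] small
    as [N * h] is fixed, and then the second for [h] small. *)
Lemma pvm_separated (B T : set R) x (d eps : R) :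
  measurable B -> measurable T -> 0 < d -> 0 < eps ->
  (forall s t, B s -> T t -> d <= `|s - t|) ->
  \forall n \near \oo, rnorm (Pn n T (P B x)) < eps.
Proof.
move=> mB mT d0 e0 BT; set y := P B x.
have e2 : 0 < eps / 2 by lra.
have [L L0 yL] := pvm_truncate dot_norm A_P y e2.
(* [s], [N] and [e'] make each of the three contributions to [sum_bound N] at
   most [eps / 8] *)
have [s s0 sE] : exists2 s : R, 0 < s & s = eps * d / (8 * L).
  by exists (eps * d / (8 * L)) => //; rewrite divr_gt0 ?mulr_gt0.
pose M := rnorm y ^+ 2; have M0 : 0 <= M by exact: sqr_ge0.
pose N := (Num.truncn (8 * L * M / (d * s * eps))).+1.
have N0 : 0 < N%:R :> R by rewrite ltr0n.
have N_large : 8 * L * M < N%:R * (d * s * eps).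
  rewrite -ltr_pdivrMr; first exact: truncnS_gt.
  by rewrite !mulr_gt0.
pose h := 2 * L / N%:R; have h0 : 0 < h by rewrite divr_gt0 ?mulr_gt0.
have hN : N%:R * h = 2 * L by rewrite /h mulrC divfK ?gt_eqF.
pose e' := eps / (8 * N%:R); have e'0 : 0 < e' by rewrite divr_gt0 ?mulr_gt0.
have e'N : 8 * (N%:R * e') = eps by rewrite /e'; field; exact: lt0r_neq0.
pose I j : set R := `](- L), (- L + j%:R * h)]%classic.
pose J j : set R := `](- L + j%:R * h), (- L + j.+1%:R * h)]%classic.
have mI j : measurable (I j) by exact: measurable_itv.
have mJ j : measurable (J j) by exact: measurable_itv.
have IS j : I j.+1 = I j `|` J j.
  rewrite /I /J -itv_bndbnd_setU// bnd_simp.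
    by rewrite lerDl mulr_ge0// ltW.
  by rewrite lerD2l ler_wpM2r ?(ltW h0)// ler_nat.
have IJ0 j : I j `&` J j = set0.
  by apply/seteqP; split => // t []; rewrite /I /J /= !in_itv/=; lra.
have cell j : \forall n \near \oo,
    rnorm (Pn n T (P (J j) y)) <= h / d * rnorm (P (J j) y) + e'.
  have uE : P (J j) y = P (J j `&` B) x by rewrite (pvmI dot_norm A_P).
  have mJB : measurable (J j `&` B) by exact: measurableI.
  have [JB0|/set0P[c [Jc Bc]]] := eqVneq (J j `&` B) set0.
    rewrite uE JB0 (pvm_set0 dot_norm A_P); near=> n.
    by rewrite (pvm0 (An_Pn n))// rnorm0 mulr0 add0r ltW.
  rewrite uE; apply: (pvm_escape (c := c) mJB mT _ h0 d0 e'0).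
  - by rewrite (pvm_idem A_P).
  - move=> t [Jt _]; move: Jt Jc; rewrite /J /= !in_itv/= -natr1 mulrDl mul1r.
    by rewrite ler_norml => /andP[? ?] /andP[? ?]; apply/andP; split; lra.
  - by move=> t Tt; rewrite distrC; exact: BT.
have sum_bound j : \forall n \near \oo, rnorm (Pn n T (P (I j) y)) <=
    h / (2 * d) * (j%:R * s + rnorm (P (I j) y) ^+ 2 / s) + j%:R * e'.
  elim: j => [|j IH].
    have -> : I 0%N = set0 by rewrite /I mul0r addr0 set_itvoc0.
    rewrite (pvm_set0 dot_norm A_P); near=> n.
    by rewrite (pvm0 (An_Pn n))// rnorm0 !(mul0r, mulr0, addr0, expr0n).
  near=> n; rewrite IS (pvmU dot_norm A_P)// (pvmD (An_Pn n))//.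
  have -> : rnorm (P (I j) y + P (J j) y) ^+ 2 =
      rnorm (P (I j) y) ^+ 2 + rnorm (P (J j) y) ^+ 2.
    by rewrite -(massU dot_norm A_P)// (pvmU dot_norm A_P).
  have IHn : rnorm (Pn n T (P (I j) y)) <=
    h / (2 * d) * (j%:R * s + rnorm (P (I j) y) ^+ 2 / s) + j%:R * e'.
    by near: n.
  have cn : rnorm (Pn n T (P (J j) y)) <= h / d * rnorm (P (J j) y) + e'.
    by near: n; exact: cell.
  set r := rnorm (P (J j) y) in cn *; set q := _ ^+ 2 / s in IHn *.
  have amgm : h / d * r <= h / (2 * d) * (s + r ^+ 2 / s).
    have -> : h / d * r = h / (2 * d) * (2 * r) by field; exact: lt0r_neq0.
    apply: ler_wpM2l; first by rewrite divr_ge0 ?mulr_ge0// ltW.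
    rewrite -(ler_pM2l s0) mulrDr [s * (r ^+ 2 / s)]mulrC divfK ?gt_eqF//.
    by have := sqr_ge0 (s - r); nra.
  apply: le_trans (ler_rnormD _ _) _.
  rewrite -natr1 [(_ + r ^+ 2) / s]mulrDl -/q; move: IHn cn amgm.
  move: q (r ^+ 2 / s) (h / (2 * d)) (h / d * r) => q p k hr; lra.
have := sum_bound N; apply: filterS => n.
rewrite /I hN (_ : - L + 2 * L = L); last by ring.
have := rnorm_pvm_le dot_norm A_P y (mI N).
rewrite /I hN (_ : - L + 2 * L = L); last by ring.
move=> yM; set w := P _ y => wn.
have wM : rnorm w ^+ 2 <= M by rewrite ler_pXn2r ?nnegrE ?rnorm_ge0.
have tri : rnorm (Pn n T y) <= rnorm (y - w) + rnorm (Pn n T w).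
  rewrite -{1}(subrK w y) (pvmD (An_Pn n))//.
  apply: le_trans (ler_rnormD _ _) _; rewrite lerD2r.
  exact: (rnorm_pvm_le dot_norm (An_Pn n)).
have b1 : h / (2 * d) * (N%:R * s) = eps / 8.
  have -> : h / (2 * d) * (N%:R * s) = (N%:R * h) * s / (2 * d).
    by field; exact: lt0r_neq0.
  by rewrite hN sE; field; rewrite !lt0r_neq0.
have b2 : h / (2 * d) * (rnorm w ^+ 2 / s) <= eps / 8.
  have -> : h / (2 * d) * (rnorm w ^+ 2 / s) =
      L * rnorm w ^+ 2 / (N%:R * (d * s)).
    by rewrite /h; field; rewrite !lt0r_neq0.
  rewrite ler_pdivrMr; last by rewrite !mulr_gt0.
  have : L * rnorm w ^+ 2 <= L * M by rewrite ler_pM2l.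
  by move: N_large; lra.
by move: wn; rewrite mulrDr b1; lra.
Unshelve. all: by end_near. Qed.

(** A substitute for the portmanteau theorem: the mass of [T] under the
    approximating measures cannot come from [B], which lies at a positive
    distance, so it is eventually bounded by the limit mass off [B]. *)
Lemma mass_escape (B T : set R) e (d eps : R) :
  measurable B -> measurable T -> 0 < d -> 0 < eps ->
  (forall s t, B s -> T t -> d <= `|s - t|) ->
  \forall n \near \oo,
    rnorm (Pn n T e) ^+ 2 <= rnorm (P (~` B) e) ^+ 2 + eps.
Proof.
move=> mB mT d0 e0 BT; pose M := rnorm (P (~` B) e).
have M0 : 0 <= M by exact: rnorm_ge0.
(* chosen so that [(M + e') ^+ 2 <= M ^+ 2 + eps] *)
pose e' := Num.min 1 (eps / (2 * M + 1)).
have e'0 : 0 < e' by rewrite lt_min ltr01 divr_gt0//; lra.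
have e'1 : e' <= 1 by rewrite ge_min lexx.
have e'M : (2 * M + 1) * e' <= eps.
  rewrite mulrC -ler_pdivlMr; last by lra.
  by rewrite ge_min lexx orbT.
have := pvm_separated e mB mT d0 e'0 BT; apply: filterS => n Bn.
have : rnorm (Pn n T e) <= e' + M.
  rewrite -{1}(subrK (P B e) e) (pvmD (An_Pn n))// addrC.
  apply: le_trans (ler_rnormD _ _) _; apply: lerD; first exact: ltW.
  rewrite -(pvmC dot_norm A_P)//.
  exact: (rnorm_pvm_le dot_norm (An_Pn n)).
rewrite -(@ler_pXn2r _ 2) ?nnegrE ?addr_ge0 ?rnorm_ge0 ?(ltW e'0)//.
move=> /le_trans; apply; rewrite -/M sqrrD.
have : e' ^+ 2 <= e' by rewrite expr2 ler_piMl// ltW.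
by nra.
Qed.

End Convergence.

(** * Equi-absolute continuity and uniform convergence *)

Section RealFunctions.
Context {R : realType}.
Variables a b : R.

(** A statement about increments only, which therefore passes to pointwise
    limits; the densities [f n] need not converge. *)
Lemma equi_ac_increments (F : nat -> R -> R) :
  equi_absolutely_continuous a b F ->
  forall eps : R, 0 < eps -> exists2 delta : R, 0 < delta &
    forall (n k : nat) (x y : 'I_k -> R),
      (forall i, a <= x i /\ x i <= y i /\ y i <= b) ->
      trivIset setT (fun i => `]x i, y i[%classic) ->
      \sum_(i < k) (y i - x i) < delta ->
      `|\sum_(i < k) (F n (y i) - F n (x i))| < eps.
Proof.
move=> [f [f_int FE f_ac]] eps e0; have [delta d0 fd] := f_ac _ e0.
exists delta => // n k x y xy tI sum_lt.
pose S := \big[setU/set0]_(i < k) `]x i, y i[%classic.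
have mI (i : 'I_k) : measurable `]x i, y i[%classic by exact: measurable_itv.
have mS : measurable S by exact: bigsetU_measurable.
have sub_ab i : `]x i, y i[%classic `<=` `[a, b]%classic.
  have [ax [_ yb]] := xy i; apply: subset_itv; rewrite bnd_simp//.
have Sab : S `<=` `[a, b]%classic.
  by rewrite /S; elim/big_ind : _ => // U V Ua Va t [/Ua|/Va].
have mSE : (@lebesgue_measure R S = (\sum_(i < k) (y i - x i))%:E)%E.
  rewrite /S measure_bigsetU_ord// -sumEFin; apply: eq_bigr => i _.
  apply: etrans (lebesgue_measure_itv _) _; rewrite /= lte_fin; have [_ [xyi _]] := xy i.
  case: ltP => [_|yx]; first by rewrite EFinB.
  suff -> : y i = x i by rewrite subrr.
  by apply/eqP; rewrite eq_le yx.
have incr i : F n (y i) - F n (x i) =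
    \int[lebesgue_measure]_(t in `]x i, y i[%classic) f n t.
  have [ax [xyi yb]] := xy i.
  have f_ay : lebesgue_measure.-integrable `[a, y i] (EFin \o f n).
    by apply: integrableS (f_int n) => //; apply: subset_itv; rewrite bnd_simp.
  have f_xy : lebesgue_measure.-integrable `]x i, y i[ (EFin \o f n).
    by apply: integrableS (f_int n).
  rewrite Rintegral_itv_bndo_bndc// -(Rintegral_itvB f_ay) ?bnd_simp//.
  by rewrite (FE n (y i)) ?(FE n (x i)) ?in_itv/=; [ring|lra|lra].
have := fd n S mS Sab; rewrite mSE lte_fin => /(_ sum_lt).
congr (`|_| < eps); under [RHS]eq_bigr do rewrite incr.
rewrite /Rintegral integral_bigsetU_EFin//=.
- rewrite sum_fine// => i _; apply: integrable_fin_num => //.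
  exact: integrableS (f_int n).
- exact: index_enum_uniq.
- exact: sub_trivIset tI.
- by apply: measurable_int; exact: integrableS (f_int n).
Qed.

(** Pointwise convergence at [x] extends to a neighbourhood of [x] by
    equicontinuity, and finitely many neighbourhoods cover the segment. *)
Lemma equicontinuous_uniform_cvg (F : nat -> R -> R) (g : R -> R) :
  (forall eps : R, 0 < eps -> exists2 delta : R, 0 < delta &
     forall n x y, a <= x -> y <= b -> x <= y -> y - x < delta ->
       `|F n y - F n x| < eps) ->
  (forall x, a <= x <= b -> (fun n => F n x) @ \oo --> g x) ->
  {uniform `[a, b], F @ \oo --> g}.
Proof.
move=> equi cvgF U /uniform_nbhs[W [+ WU]].
rewrite -entourage_ballE => -[eps /= e0 epsW].
suff Fg : \forall n \near \oo, `[a, b]%classic `<=`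
    [set x | a <= x <= b -> `|g x - F n x| < eps].
  rewrite nbhs_simpl/=; apply: filterS Fg => n Fn; apply: WU => x xab.
  by apply: epsW => /=; apply: Fn => //; move: xab; rewrite /= in_itv.
have e4 : 0 < eps / 8 by rewrite divr_gt0.
have [delta d0 Fd] := equi _ e4.
have {}Fd n x y : a <= x <= b -> a <= y <= b -> `|x - y| < delta ->
    `|F n x - F n y| < eps / 8.
  move=> /andP[ax xb] /andP[ay yb].
  have [xy|/ltW xy] := leP x y.
    by rewrite ler0_norm ?subr_le0// opprB distrC; exact: Fd.
  by rewrite ger0_norm ?subr_ge0//; exact: Fd.
have Fnear x : a <= x <= b ->
    \forall n \near \oo, `|g x - F n x| < eps / 8.
  by move=> /cvgF /cvgrPdist_lt; apply.
have gd x y : a <= x <= b -> a <= y <= b -> `|x - y| < delta ->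
    `|g x - g y| < eps / 2.
  move=> xab yab xy; have [n [Fx Fy]] := filter_ex (filterI (Fnear x xab) (Fnear y yab)).
  have := Fd n x y xab yab xy; move: Fx Fy; rewrite !ltr_norml.
  by move=> /andP[? ?] /andP[? ?] /andP[? ?]; apply/andP; split; lra.
have /compact_near_coveringP := @segment_compact R a b; apply.
move=> x; rewrite /= in_itv/= => xab.
exists (ball x delta, [set n | `|g x - F n x| < eps / 8]).
  by split; [exact: nbhsx_ballx|exact: Fnear].
move=> [y n] [/= xy Fx] yab; have := gd x y xab yab xy.
have := Fd n x y xab yab xy; move: Fx; rewrite !ltr_norml.
by move=> /andP[? ?] /andP[? ?] /andP[? ?]; apply/andP; split; lra.
Qed.

End RealFunctions.

(** * Transfer from a generating subspace to all vectors *)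

Section GeneratingSubspace.
Context {R : realType} {H : completeNormedModType R[i]}.
Variable dot : {dot H for (@Num.conj R[i])}.
Hypothesis dot_norm : forall x : H, dot x x = `|x| ^+ 2.
Variables (A : operator H) (P : set R -> H -> H).
Hypothesis A_P : spectral_measure dot A P.
Variable small : R -> set (set R).
Hypothesis small_measurable : forall delta S, small delta S -> measurable S.
Hypothesis small_mono : forall delta delta' S,
  delta <= delta' -> small delta S -> small delta' S.

(** Covers two uses at once: absolute continuity, where [small delta] consists
    of the unions of intervals of total length less than [delta], and absence
    of an atom, where it is a single point. *)
Definition vanishes_on_small (e : H) : Prop :=
  forall eps : R, 0 < eps -> exists2 delta : R, 0 < delta &
    forall S, small delta S -> rnorm (P S e) < eps.

Lemma vanishes_on_small0 : vanishes_on_small 0.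
Proof.
move=> eps e0; exists 1 => // S /small_measurable mS.
by rewrite (pvm0 A_P)// rnorm0.
Qed.

Lemma vanishes_on_smallD e f :
  vanishes_on_small e -> vanishes_on_small f -> vanishes_on_small (e + f).
Proof.
move=> se sf eps e0; have e2 : 0 < eps / 2 by lra.
have [d1 d10 ed] := se _ e2; have [d2 d20 fd] := sf _ e2.
exists (Num.min d1 d2); first by rewrite lt_min d10.
move=> S sS; have := small_measurable sS => mS.
rewrite (pvmD A_P)//; apply: le_lt_trans (ler_rnormD _ _) _.
have /ed : small d1 S by apply: small_mono sS; rewrite ge_min lexx.
have /fd : small d2 S by apply: small_mono sS; rewrite ge_min lexx orbT.
lra.
Qed.

Lemma vanishes_on_smallZ c e : vanishes_on_small e -> vanishes_on_small (c *: e).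
Proof.
move=> se eps e0; pose k : R := complex.Re `|c| + 1.
have k0 : 0 < k.
  suff : 0 <= complex.Re `|c| by rewrite /k; lra.
  by rewrite -ler0c RRe_real// ger0_real.
have [d d0 ed] := se (eps / k) (divr_gt0 e0 k0); exists d => // S sS.
rewrite (pvmZ A_P) ?rnormZ; last exact: small_measurable sS.
have := ed S sS; rewrite ltr_pdivlMr// => /(le_lt_trans _); apply.
by rewrite ler_wpM2l ?rnorm_ge0// lerDl.
Qed.

Lemma vanishes_on_small_pvm B e :
  measurable B -> vanishes_on_small e -> vanishes_on_small (P B e).
Proof.
move=> mB se eps e0; have [d d0 ed] := se _ e0; exists d => // S sS.
have mS := small_measurable sS.
rewrite (pvm_comm dot_norm A_P)//; apply: le_lt_trans (ed S sS).
exact: (rnorm_pvm_le dot_norm A_P).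
Qed.

Lemma vanishes_on_small_closure (X : set H) e :
  (forall x, X x -> vanishes_on_small x) -> closure X e -> vanishes_on_small e.
Proof.
move=> sX Xe eps e0; have e2 : 0 < eps / 2 by lra.
have e2C : (0 : R[i]) < (eps / 2)%:C%C by rewrite ltcR.
have [x [Xx]] := Xe _ (nbhsx_ballx e _ e2C).
rewrite -ball_normE/= -rnormE ltcR => ex.
have [d d0 xd] := sX _ Xx _ e2; exists d => // S sS.
have mS := small_measurable sS.
rewrite -(subrK x e) (pvmD A_P)//; apply: le_lt_trans (ler_rnormD _ _) _.
have := rnorm_pvm_le dot_norm A_P (e - x) mS; have := xd S sS; lra.
Qed.

(** The vectors vanishing on small sets form a closed subspace invariant under
    the spectral measure, so a generating subspace detects this property. *)
Lemma generating_vanishes_on_small (G : set H) :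
  generating_subspace P G -> (forall g, G g -> vanishes_on_small g) ->
  forall e, vanishes_on_small e.
Proof.
move=> [_ G_gen] sG e.
have : closure (linear_span [set x | exists (D : interval R) (g : H),
  G g /\ x = P [set` D] g]) e by rewrite G_gen.
apply: vanishes_on_small_closure => x [n [c [v [vG ->]]]].
elim/big_ind: _ => [| |i _].
- exact: vanishes_on_small0.
- exact: vanishes_on_smallD.
- apply: vanishes_on_smallZ; have [D [g [Gg ->]]] := vG i.
  by apply: vanishes_on_small_pvm; [exact: measurable_itv|exact: sG].
Qed.

End GeneratingSubspace.

(** * Resolutions of the identity *)

Section ResolutionOfIdentity.
Context {R : realType} {H : completeNormedModType R[i]}.
Variable dot : {dot H for (@Num.conj R[i])}.
Hypothesis dot_norm : forall x : H, dot x x = `|x| ^+ 2.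
Variables (A : operator H) (P : set R -> H -> H) (E : R -> H -> H).
Hypothesis A_P : spectral_measure dot A P.
Hypothesis P_E : resolution_of_identity P E.

Local Notation mass B x := (rnorm (P B x) ^+ 2).

Lemma spectral_function_bounds e l :
  mass `]-oo, l[%classic e <= spectral_function dot E e l
    <= mass `]-oo, l]%classic e.
Proof.
have sub : mass `]-oo, l[%classic e <= mass `]-oo, l]%classic e.
  by apply: (mass_le dot_norm A_P) => // t /=; rewrite !in_itv/=; exact: ltW.
by rewrite /spectral_function; case: (P_E l) => ->;
  rewrite (spectral_massE dot_norm A_P)// sub lexx.
Qed.

(** The open ray at [b] is exhausted by closed rays; [mass_ray_right] is the
    dual approximation of a closed ray from outside. *)
Lemma mass_ray_left e b (eps : R) : 0 < eps ->
  exists2 l, l < b & mass `]-oo, b[%classic e - eps <= mass `]-oo, l]%classic e.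
Proof.
move=> e0; pose F n : set R := `]-oo, b - n.+1%:R^-1]%classic.
have hF : {homo F : n m / (n <= m)%N >-> (n <= m)%O}.
  move=> n m nm; apply/subsetPset; apply: subset_itv; rewrite bnd_simp//.
  by rewrite lerD2l lerN2 lef_pV2 ?posrE// ler_nat.
have FE : \bigcup_n F n = `]-oo, b[%classic.
  apply/seteqP; split => [t [n _]|t]; rewrite /F/= !in_itv/=.
    by move=> tn; rewrite (le_lt_trans tn)// ltrBlDr ltrDl invr_gt0.
  rewrite -subr_gt0 => tb; exists (Num.truncn (b - t)^-1) => //=.
  rewrite in_itv/= lerBrDl -lerBrDr invf_ple ?posrE//.
  by apply: ltW; exact: truncnS_gt.
have := @mass_cvg_bigcup _ _ _ dot_norm _ _ A_P F e (fun n => measurable_itv _) hF.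
rewrite FE => /cvgrPdist_lt/(_ eps e0)[n _ /(_ n (leqnn n)) /=] Fn.
exists (b - n.+1%:R^-1); first by rewrite ltrBlDr ltrDl invr_gt0.
by move: Fn; rewrite ltr_norml /F => /andP[_]; lra.
Qed.

Lemma mass_ray_right e a (eps : R) : 0 < eps ->
  exists2 l, a < l & mass `]-oo, l[%classic e <= mass `]-oo, a]%classic e + eps.
Proof.
move=> e0; pose F n : set R := `]-oo, a + n.+1%:R^-1[%classic.
have hF : {homo F : n m / (n <= m)%N >-> (m <= n)%O}.
  move=> n m nm; apply/subsetPset; apply: subset_itv; rewrite bnd_simp//.
  by rewrite lerD2l lef_pV2 ?posrE// ler_nat.
have FE : \bigcap_n F n = `]-oo, a]%classic.
  apply/seteqP; split => [t Ft|t at_ n _]; last first.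
    by move: at_; rewrite /F/= !in_itv/= => /le_lt_trans; apply; rewrite ltrDl invr_gt0.
  rewrite /= in_itv/= leNgt; apply/negP; rewrite -subr_gt0 => ta.
  have := Ft (Num.truncn (t - a)^-1) I; rewrite /F/= in_itv/= -ltrBlDl.
  rewrite ltNge => /negP; apply; rewrite invf_ple ?posrE//.
  by apply: ltW; exact: truncnS_gt.
have := @mass_cvg_bigcap _ _ _ dot_norm _ _ A_P F e (fun n => measurable_itv _) hF.
rewrite FE => /cvgrPdist_lt/(_ eps e0)[n _ /(_ n (leqnn n)) /=] Fn.
exists (a + n.+1%:R^-1); first by rewrite ltrDl invr_gt0.
by move: Fn; rewrite ltr_norml /F => /andP[+ _]; lra.
Qed.

Section NoInteriorAtoms.
Variables a b : R.

(** The normalization of [E] that is right-continuous at [a] and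
    left-continuous at [b], so that possible atoms at the endpoints do not
    contribute to its increments on [`[a, b]]. *)
Definition renormalized (l : R) : H -> H :=
  if l == a then P `]-oo, a]%classic
  else if l == b then P `]-oo, b[%classic else E l.

Lemma renormalized_resolution : resolution_of_identity P renormalized.
Proof.
move=> l; rewrite /renormalized; have [->|_] := eqVneq l a; first by right.
by have [->|_] := eqVneq l b; [left|exact: P_E].
Qed.

Variable e : H.
Hypothesis no_atom : forall l, a < l < b -> P [set l] e = 0.

Lemma mass_ray_no_atom l : a < l < b ->
  mass `]-oo, l]%classic e = mass `]-oo, l[%classic e.
Proof.
move=> lab; have -> : `]-oo, l]%classic = `]-oo, l[%classic `|` [set l].
  by rewrite setUitv1.
rewrite (massU dot_norm A_P)// ?no_atom ?rnorm0 ?expr0n ?addr0//.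
by apply/seteqP; split => // t [/=]; rewrite in_itv/= => /[swap] ->; rewrite ltxx.
Qed.

Lemma renormalized_right x : a < b -> a <= x -> x < b ->
  spectral_function dot renormalized e x = mass `]-oo, x]%classic e.
Proof.
move=> ab ax xb; rewrite /spectral_function /renormalized.
have [->|xa] := eqVneq x a; first by rewrite (spectral_massE dot_norm A_P).
have xab : a < x < b by rewrite lt_def xa ax.
rewrite (lt_eqF xb); case: (P_E x) => ->; rewrite (spectral_massE dot_norm A_P)//.
by rewrite mass_ray_no_atom.
Qed.

Lemma renormalized_left x : a < b -> a < x -> x <= b ->
  spectral_function dot renormalized e x = mass `]-oo, x[%classic e.
Proof.
move=> ab ax xb; rewrite /spectral_function /renormalized (gt_eqF ax).
have [->|xnb] := eqVneq x b; first by rewrite (spectral_massE dot_norm A_P).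
have xab : a < x < b by rewrite ax lt_neqAle xnb.
case: (P_E x) => ->; rewrite (spectral_massE dot_norm A_P)//.
by rewrite mass_ray_no_atom.
Qed.

Lemma renormalized_increment x y : a < b -> a <= x -> x <= y -> y <= b ->
  spectral_function dot renormalized e y - spectral_function dot renormalized e x
  = mass `]x, y[%classic e.
Proof.
move=> ab ax; rewrite le_eqVlt => /predU1P[<- _|xy yb].
  rewrite subrr (_ : `]x, x[%classic = set0) ?set_itvoo0//.
  by rewrite (pvm_set0 dot_norm A_P) rnorm0 expr0n.
have ay := le_lt_trans ax xy; have xb := lt_le_trans xy yb.
rewrite renormalized_left// renormalized_right//.
have -> : `]-oo, y[%classic = `]-oo, x]%classic `|` `]x, y[%classic.
  by rewrite -itv_bndbnd_setU// bnd_simp.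
rewrite (massU dot_norm A_P)//; first by ring.
by apply/seteqP; split => // t [] /=; rewrite !in_itv/=; lra.
Qed.

Lemma renormalized_increments_sum k (x y : 'I_k -> R) : a < b ->
  (forall i, a <= x i /\ x i <= y i /\ y i <= b) ->
  trivIset setT (fun i => `]x i, y i[%classic) ->
  \sum_(i < k) (spectral_function dot renormalized e (y i)
                - spectral_function dot renormalized e (x i))
  = mass (\big[setU/set0]_(i < k) `]x i, y i[%classic) e.
Proof.
move=> ab xy tI; rewrite (mass_bigsetU dot_norm A_P)//.
apply: eq_bigr => i _; have [ax [xyi yb]] := xy i.
exact: renormalized_increment.
Qed.

End NoInteriorAtoms.
End ResolutionOfIdentity.

(** * Limits of spectral functions *)

Section SpectralConvergence.
Context {R : realType} {H : completeNormedModType R[i]}.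
Variable dot : {dot H for (@Num.conj R[i])}.
Hypothesis dot_norm : forall x : H, dot x x = `|x| ^+ 2.
Variables (a b : R).
Hypothesis ab : a < b.
Variables (An : nat -> operator H) (Pn : nat -> set R -> H -> H).
Variable En : nat -> R -> H -> H.
Hypothesis An_sa : forall n, self_adjoint dot (An n).
Hypothesis An_Pn : forall n, spectral_measure dot (An n) (Pn n).
Hypothesis Pn_En : forall n, resolution_of_identity (Pn n) (En n).
Variables (A : operator H) (P : set R -> H -> H) (E : R -> H -> H).
Hypothesis A_sa : self_adjoint dot A.
Hypothesis A_P : spectral_measure dot A P.
Hypothesis P_E : resolution_of_identity P E.
Variable Phi : set H.
Hypothesis Phi_dom : forall n, Phi `<=` op_dom (An n).
Hypothesis An_A : closure (strong_limit_graph An Phi) = op_graph A.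

Local Notation mass B x := (rnorm (P B x) ^+ 2).
Local Notation sn e n l := (spectral_function dot (En n) e l).
Local Notation s' e l := (spectral_function dot (renormalized P E a b) e l).

(** Both this bound and [spectral_function_le] are [mass_escape] for two
    disjoint rays, one of them passed to the complement by the equality of
    total masses. A gap between [l] and [l'] is needed, as spectrum near [l] may
    move across [l] in the limit. *)
Lemma spectral_function_ge e (l l' eps : R) : l < l' -> 0 < eps ->
  \forall n \near \oo, mass `]-oo, l]%classic e - eps <= sn e n l'.
Proof.
move=> ll' e0; have d0 : 0 < l' - l by rewrite subr_gt0.
have mT : measurable (`[l', +oo[%classic : set R) by exact: measurable_itv.
have mB : measurable (`]-oo, l]%classic : set R) by exact: measurable_itv.
have sep s t : `]-oo, l]%classic s -> `[l', +oo[%classic t -> l' - l <= `|s - t|.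
  by rewrite /= !in_itv/= andbT => sl lt; rewrite ler0_norm ?opprB; lra.
apply: filterS (mass_escape dot_norm An_sa An_Pn A_sa A_P Phi_dom An_A e mB mT
  d0 e0 sep) => n.
have /andP[lo _] := spectral_function_bounds dot_norm (An_Pn n) (Pn_En n) e l'.
rewrite (massC dot_norm A_P)//; move: lo.
by rewrite -setCitvr (massC dot_norm (An_Pn n))//; lra.
Qed.

Lemma spectral_function_le e (l l' eps : R) : l' < l -> 0 < eps ->
  \forall n \near \oo, sn e n l' <= mass `]-oo, l[%classic e + eps.
Proof.
move=> ll' e0; have d0 : 0 < l - l' by rewrite subr_gt0.
have mT : measurable (`]-oo, l']%classic : set R) by exact: measurable_itv.
have mB : measurable (`[l, +oo[%classic : set R) by exact: measurable_itv.
have sep s t : `[l, +oo[%classic s -> `]-oo, l']%classic t -> l - l' <= `|s - t|.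
  by rewrite /= !in_itv/= andbT => sl lt; rewrite ger0_norm; lra.
apply: filterS (mass_escape dot_norm An_sa An_Pn A_sa A_P Phi_dom An_A e mB mT
  d0 e0 sep) => n.
have /andP[_ up] := spectral_function_bounds dot_norm (An_Pn n) (Pn_En n) e l'.
by rewrite setCitvr; lra.
Qed.

Section EquiContinuousVector.
Variable e : H.
Hypothesis equi : forall eps : R, 0 < eps -> exists2 delta : R, 0 < delta &
  forall n x y, a <= x -> y <= b -> x <= y -> y - x < delta ->
    `|sn e n y - sn e n x| < eps.

(** Equicontinuity closes the gap between [l] and [l'] left open by
    [spectral_function_ge]. *)
Lemma limit_lower l (eps : R) : a <= l -> l < b -> 0 < eps ->
  \forall n \near \oo, mass `]-oo, l]%classic e - eps <= sn e n l.
Proof.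
move=> al lb e0; have e2 : 0 < eps / 2 by rewrite divr_gt0.
have [delta d0 sd] := equi e2.
pose h := Num.min (delta / 2) (b - l).
have h0 : 0 < h by rewrite lt_min subr_gt0 lb divr_gt0.
have hd : h <= delta / 2 by rewrite ge_min lexx.
have hb : h <= b - l by rewrite ge_min lexx orbT.
have lh : l < l + h by rewrite ltrDl.
have := spectral_function_ge e lh e2; apply: filterS => n.
have := sd n l (l + h) al; rewrite ltr_norml.
have -> : l + h <= b by lra.
have -> : l + h - l < delta by lra.
by move=> /(_ erefl (ltW lh) erefl) /andP[]; lra.
Qed.

Lemma limit_upper l (eps : R) : a < l -> l <= b -> 0 < eps ->
  \forall n \near \oo, sn e n l <= mass `]-oo, l[%classic e + eps.
Proof.
move=> al lb e0; have e2 : 0 < eps / 2 by rewrite divr_gt0.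
have [delta d0 sd] := equi e2.
pose h := Num.min (delta / 2) (l - a).
have h0 : 0 < h by rewrite lt_min subr_gt0 al divr_gt0.
have hd : h <= delta / 2 by rewrite ge_min lexx.
have hb : h <= l - a by rewrite ge_min lexx orbT.
have lh : l - h < l by rewrite ltrBlDr ltrDl.
have := spectral_function_le e lh e2; apply: filterS => n.
have := sd n (l - h) l; rewrite ltr_norml.
have -> : a <= l - h by lra.
have -> : l - (l - h) < delta by lra.
by move=> /(_ erefl lb (ltW lh) erefl) /andP[]; lra.
Qed.

(** The increments of the approximating spectral functions around an interior
    point are uniformly small, which leaves no room for an atom of the limit. *)
Lemma equicontinuous_no_atom l : a < l < b -> P [set l] e = 0.
Proof.
move=> /andP[al lb]; apply: rnorm0_eq0; apply/eqP; rewrite -sqrf_eq0.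
rewrite eq_le sqr_ge0 andbT; apply/ler_addgt0Pr => eps e0.
have e2 : 0 < eps / 2 by rewrite divr_gt0.
have [n [lo up]] := filter_ex (filterI (limit_lower (ltW al) lb e2)
                                       (limit_upper al (ltW lb) e2)).
move: lo; have -> : `]-oo, l]%classic = `]-oo, l[%classic `|` [set l].
  by rewrite setUitv1.
rewrite (massU dot_norm A_P)//; first by lra.
by apply/seteqP; split => // t [/=]; rewrite in_itv/= => /[swap] ->; rewrite ltxx.
Qed.

Lemma spectral_function_cvg l : a <= l <= b ->
  (fun n => sn e n l) @ \oo --> s' e l.
Proof.
move=> /andP[al lb]; apply/cvgrPdist_le => eps e0.
have e2 : 0 < eps / 2 by rewrite divr_gt0.
(* at the endpoints there is no room inside [`[a, b]] on one side, and
   monotone approximation of the ray replaces equicontinuity there *)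
have lower : \forall n \near \oo, s' e l - eps <= sn e n l.
  move: lb; rewrite le_eqVlt => /predU1P[->|lb].
    rewrite (renormalized_left dot_norm A_P P_E equicontinuous_no_atom)//.
    have [x xb xe] := mass_ray_left dot_norm A_P e b e2.
    by have := spectral_function_ge e xb e2; apply: filterS => n; lra.
  rewrite (renormalized_right dot_norm A_P P_E equicontinuous_no_atom)//.
  exact: limit_lower.
have upper : \forall n \near \oo, sn e n l <= s' e l + eps.
  move: al; rewrite le_eqVlt => /predU1P[<-|al].
    rewrite (renormalized_right dot_norm A_P P_E equicontinuous_no_atom)//.
    have [x xa xe] := mass_ray_right dot_norm A_P e a e2.
    by have := spectral_function_le e xa e2; apply: filterS => n; lra.
  rewrite (renormalized_left dot_norm A_P P_E equicontinuous_no_atom)//.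
  exact: limit_upper.
apply: filterS2 lower upper => n lo up.
by rewrite ler_norml; apply/andP; split; lra.
Qed.

End EquiContinuousVector.

Lemma equi_ac_equicontinuous (F : nat -> R -> R) :
  equi_absolutely_continuous a b F ->
  forall eps : R, 0 < eps -> exists2 delta : R, 0 < delta &
    forall n x y, a <= x -> y <= b -> x <= y -> y - x < delta ->
      `|F n y - F n x| < eps.
Proof.
move=> /equi_ac_increments Fac eps e0; have [delta d0 Fd] := Fac _ e0.
exists delta => // n x y ax yb xy xyd.
have := Fd n 1%N (fun=> x) (fun=> y); rewrite !big_ord1; apply => //.
by move=> i j _ _ _; rewrite !ord1.
Qed.

Variable G : set H.
Hypothesis G_gen : generating_subspace P G.
Hypothesis G_equi : forall e, G e ->
  equi_absolutely_continuous a b (fun n => spectral_function dot (En n) e).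

Lemma no_interior_atom e l : a < l < b -> P [set l] e = 0.
Proof.
move=> lab; apply: rnorm0_eq0; apply/eqP; rewrite eq_le rnorm_ge0 andbT.
apply/ler_addgt0Pr => eps e0; rewrite add0r.
pose small (delta : R) := [set [set l]].
have [| | |delta _] := generating_vanishes_on_small dot_norm A_P
  (small := small) _ _ G_gen _ e e0; last by move=> /(_ _ erefl)/ltW.
- by move=> d S ->.
- by [].
- move=> g /G_equi/equi_ac_equicontinuous g_equi eta eta0; exists 1 => // S ->.
  by rewrite (equicontinuous_no_atom g_equi lab) rnorm0.
Qed.

Definition short_union (delta : R) : set (set R) :=
  [set S | exists (k : nat) (x y : 'I_k -> R),
    [/\ forall i, a <= x i /\ x i <= y i /\ y i <= b,
        trivIset setT (fun i => `]x i, y i[%classic),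
        \sum_(i < k) (y i - x i) < delta
      & S = \big[setU/set0]_(i < k) `]x i, y i[%classic]].

(** The increments over a short union are limits of increments that are
    uniformly small by hypothesis. *)
Lemma generating_vanishes_on_short g : G g ->
  vanishes_on_small P short_union g.
Proof.
move=> Gg eps e0; have e2 : 0 < eps ^+ 2 / 2 by rewrite divr_gt0// exprn_gt0.
have [delta d0 gd] := equi_ac_increments (G_equi Gg) e2.
exists delta => // _ [k [x [y [xy tI sum_lt ->]]]].
rewrite -(@ltr_pXn2r _ 2) ?nnegrE ?rnorm_ge0 ?ltW//.
apply: (@le_lt_trans _ _ (eps ^+ 2 / 2)); last by have := exprn_gt0 2 e0; lra.
rewrite -(renormalized_increments_sum dot_norm A_P P_E (no_interior_atom g))//.
have cvg_sum : (fun n => \sum_(i < k) (sn g n (y i) - sn g n (x i))) @ \oo -->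
    \sum_(i < k) (s' g (y i) - s' g (x i)).
  apply: cvg_big => [|i _]; first exact: add_continuous.
  have [ax [xyi yb]] := xy i.
  have g_equi := equi_ac_equicontinuous (G_equi Gg).
  by apply: cvgB; apply: (spectral_function_cvg g_equi);
    rewrite ?ax ?yb ?(le_trans xyi)// (le_trans ax).
apply: (cvgr_to_le cvg_sum); near=> n.
by apply: le_trans (ler_norm _) _; apply/ltW/gd.
Unshelve. all: by end_near. Qed.

(** The sum of the increments over disjoint intervals is the squared norm of a
    single spectral projection of [e], whose smallness is a property of
    vectors that a generating subspace transfers to the whole space. *)
Lemma ac_spectrum_limit : ac_spectrum_on dot a b (renormalized P E a b).
Proof.
move=> e eps e0; have se0 : 0 < Num.sqrt eps by rewrite sqrtr_gt0.
have [| |delta d0 ed] := generating_vanishes_on_small dot_norm A_P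
  (small := short_union) _ _ G_gen generating_vanishes_on_short e se0.
- move=> d _ [k [x [y [_ _ _ ->]]]].
  by apply: bigsetU_measurable => i _; exact: measurable_itv.
- move=> d d' S dd' [k [x [y [xy tI sum_lt ->]]]]; exists k, x, y.
  by split => //; exact: lt_le_trans dd'.
exists delta => // k x y xy tI sum_lt.
have := ed (\big[setU/set0]_(i < k) `]x i, y i[%classic).
rewrite -(@ltr_pXn2r _ 2) ?nnegrE ?rnorm_ge0 ?sqrtr_ge0// sqr_sqrtr ?ltW//.
rewrite -(renormalized_increments_sum dot_norm A_P P_E (no_interior_atom e))//.
under [X in _ -> X < _]eq_bigr => i _.
  have [ax [xyi yb]] := xy i.
  rewrite (renormalized_increment dot_norm A_P P_E (no_interior_atom e))//.
  rewrite ger0_norm ?sqr_ge0//.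
  rewrite -(renormalized_increment dot_norm A_P P_E (no_interior_atom e))//.
  over.
by apply; exists k, x, y.
Qed.

Lemma uniform_spectral_cvg e : G e ->
  {uniform `[a, b],
    (fun n => spectral_function dot (En n) e) @ \oo -->
    spectral_function dot (renormalized P E a b) e}.
Proof.
move=> Ge; have e_equi := equi_ac_equicontinuous (G_equi Ge).
apply: equicontinuous_uniform_cvg => //.
exact: (spectral_function_cvg e_equi).
Qed.

End SpectralConvergence.

(** * Convergence and absolute continuity *)

Theorem theorem1p1 (R : realType) (H : completeNormedModType R[i])
  (dot : {dot H for (@Num.conj R[i])})
  (dot_norm : forall x : H, dot x x = `|x| ^+ 2)
  (H_separable : separable H)
  (a b : R) (ab : a < b)
  (* the operators A_n, their spectral measures and resolutions of identity *)
  (An : nat -> operator H) (Pn : nat -> set R -> H -> H)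
  (En : nat -> R -> H -> H)
  (An_sa : forall n, self_adjoint dot (An n))
  (An_Pn : forall n, spectral_measure dot (An n) (Pn n))
  (Pn_En : forall n, resolution_of_identity (Pn n) (En n))
  (An_ac : forall n, ac_spectrum_on dot a b (En n))
  (* the limit operator A, its spectral measure and resolution of identity *)
  (A : operator H) (P : set R -> H -> H) (E : R -> H -> H)
  (A_sa : self_adjoint dot A)
  (A_P : spectral_measure dot A P)
  (P_E : resolution_of_identity P E)
  (* A is the closure of the strong limit of the A_n on Phi *)
  (Phi : set H) (Phi_dense : dense Phi)
  (Phi_dom : forall n, Phi `<=` op_dom (An n))
  (An_cvg : forall e, Phi e -> cvgn (fun n => An n e))
  (An_A : closure (strong_limit_graph An Phi) = op_graph A)
  (ab_spectrum : forall t : R, t \in `[a, b] -> spectrum A t%:C%C)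
  (G : set H) (G_gen : generating_subspace P G)
  (G_equi : forall e, G e ->
     equi_absolutely_continuous a b (fun n => spectral_function dot (En n) e)) :
  (* E' is E, possibly renormalized at the jumps at a and b *)
  exists E' : R -> H -> H,
    [/\ resolution_of_identity P E',
        forall l, l != a -> l != b -> E' l = E l,
        ac_spectrum_on dot a b E'
      & forall e, G e ->
          {uniform `[a, b],
            (fun n => spectral_function dot (En n) e) @ \oo -->
            spectral_function dot E' e}].
Proof.
exists (renormalized P E a b); split.
- exact: renormalized_resolution.
- by move=> l la lb; rewrite /renormalized (negbTE la) (negbTE lb).
- exact: (ac_spectrum_limit dot_norm ab An_sa An_Pn Pn_En A_sa A_P P_E Phi_dom
    An_A G_gen G_equi).
- exact: (uniform_spectral_cvg dot_norm ab An_sa An_Pn Pn_En A_sa A_P P_E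
    Phi_dom An_A G_equi).
Qed.
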